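(* Let $(\mathscr{X},\Delta)$ be a tame, separably rooted log stacky curve over a field $k$ with signature $\sigma=(0;e_1,\dots,e_r;\delta)$, and suppose $\deg D>0$ where $D=K_{\mathscr{X}}+\Delta$. Let $m=\operatorname{lcm}(1,e_1,\dots,e_r)$ and let $s$ be the saturation of $\operatorname{Eff}(D)$. Then the canonical ring $R=\bigoplus_{d\ge0}H^0(\mathscr{X},dD)$ of $(\mathscr{X},\Delta)$ is generated by elements of degree at most $m+s$ with relations of degree at most $2(m+s)$.
   Context: A log stacky curve $(\mathscr{X},\Delta)$ is a smooth proper geometrically connected one-dimensional Deligne--Mumford stack over $k$ with a dense open subscheme, with $\Delta$ a sum of distinct nonstacky points. It is tame if stabilizer orders are prime to $\operatorname{char}k$, and separably rooted if every stacky point is defined over a separable extension of $k$. The signature $(g;e_1,\dots,e_r;\delta)$ records the genus of the coarse space $X$, the stabilizer orders $e_i\geq2$ of the geometric stacky points $P_i$, and $\delta=\deg\Delta$. As a $\mathbb{Q}$-divisor on $X$, $K_{\mathscr{X}}=K_X+\sum_i(1-\frac1{e_i})P_i$, and $H^0(\mathscr{X},dD)=H^0(X,\lfloor dD\rfloor)$ with coefficientwise floors; here $\deg D=-2+\delta+\sum_i(1-1/e_i)$ and $\deg\lfloor dD\rfloor=-2d+\delta d+\sum_i\lfloor d(1-1/e_i)\rfloor$. $\operatorname{Eff}(D)=\{d\in\mathbb{Z}_{\geq0}:\deg\lfloor dD\rfloor\geq0\}$, a monoid. The saturation of a monoid $M\subseteq\mathbb{Z}_{\geq0}$ is the smallest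 integer $s$ such that $M\supseteq\mathbb{Z}_{\geq s}$. ''Generated by elements of degree at most $N$ with relations of degree at most $M$'' means there is a graded presentation $R\simeq k[x_1,\dots,x_n]/I$ with $\deg x_i\leq N$ and $I$ generated by homogeneous elements of degree at most $M$. *)

(* Defs.v *)
(* A smooth proper geometrically connected curve X over k is represented by its
   function field F, together with iota : k -> F; the closed points of X are the
   discrete valuations of F that are trivial on k.  A tame log stacky curve
   (XX, Delta) is represented by its coarse space X, the stabilizer order at each
   closed point of X, and the set of closed points whose sum is Delta; the divisor
   K_XX + Delta and its spaces of sections are then computed on X. *)

From HB Require Import structures.
From mathcomp Require Import all_boot all_order all_algebra all_field.
From mathcomp Require Import boolp classical_sets cardinality fsbigop.
From mathcomp Require Import mpoly.

Set Implicit Arguments.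
Unset Strict Implicit.
Unset Printing Implicit Defensive.

Import Order.TTheory GRing.Theory Num.Theory.
Local Open Scope classical_set_scope.
Local Open Scope ring_scope.

(* The value at 0 carries no information (it should be +oo); fixing it to 0 makes
   equal valuations equal records. *)
Record place (k F : fieldType) (iota : {rmorphism k -> F}) := Place {
  val_at :> F -> int;
  val_at0 : val_at 0 = 0;
  val_atM : forall f g, f != 0 -> g != 0 -> val_at (f * g) = val_at f + val_at g;
  val_atD : forall f g, f != 0 -> g != 0 -> f + g != 0 ->
    Order.min (val_at f) (val_at g) <= val_at (f + g);
  val_at_const : forall c : k, c != 0 -> val_at (iota c) = 0;
  val_at_unif : exists f, val_at f = 1
}.

HB.instance Definition _ (k F : fieldType) (iota : {rmorphism k -> F}) :=
  gen_eqMixin (place iota).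
HB.instance Definition _ (k F : fieldType) (iota : {rmorphism k -> F}) :=
  gen_choiceMixin (place iota).

Section Curve.
Variables (k F : fieldType) (iota : {rmorphism k -> F}).
Implicit Types (P : place iota) (V W : set F).

Definition local_ring P : set F := [set f | 0 <= P f].
Definition max_ideal P : set F := [set f | f = 0 \/ 0 < P f].

(* dim_k (V / W) = n, for k-subspaces W of V in F: the classes of b form a basis *)
Definition has_quot_dim V W (n : nat) : Prop :=
  exists b : 'I_n -> F, (forall i, V (b i)) /\
    forall f, V f ->
      exists! c : {ffun 'I_n -> k}, W (f - \sum_i iota (c i) * b i).

(* junk value 0 in infinite dimension *)
Definition quot_dim V W : nat := xget 0%N [set n | has_quot_dim V W n].

Definition pt_degree P : nat := quot_dim (local_ring P) (max_ideal P).

(* Divisors with coefficients in a Zmodule G (below, int and rat). *)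
Definition is_divisor (G : zmodType) (A : place iota -> G) : Prop :=
  finite_set [set P | A P != 0].

Definition deg (G : zmodType) (A : place iota -> G) : G :=
  \sum_(P \in [set: place iota]) A P *+ pt_degree P.

(* H^0(X, O_X(A)) *)
Definition sections (A : place iota -> int) : set F :=
  [set f | f = 0 \/ forall P, 0 <= P f + A P].

(* F is finitely generated of transcendence degree 1: it is finite over k(x) for
   some x transcendental over k. *)
Definition one_variable_function_field : Prop :=
  exists x : F, ~ algebraicOver iota x /\
    exists n (b : 'I_n -> F), forall f : F,
      exists (q : {poly k}) (p : 'I_n -> {poly k}), q != 0 /\
        (map_poly iota q).[x] * f = \sum_i (map_poly iota (p i)).[x] * b i.

(* H^0(X, O_X) = k; for X smooth and proper this is geometric connectedness. *)
Definition full_constant_field : Prop :=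
  forall f : F, algebraicOver iota f -> exists c, f = iota c.

(* k-derivations O_P -> kappa(P), represented by lifts O_P -> O_P that are
   additive, Leibniz and zero on k only modulo the maximal ideal; the values of d
   outside O_P are irrelevant. *)
Definition residue_derivation P (d : F -> F) : Prop :=
  [/\ forall f, local_ring P f -> local_ring P (d f),
      forall f g, local_ring P f -> local_ring P g ->
        max_ideal P (d (f + g) - (d f + d g)),
      forall f g, local_ring P f -> local_ring P g ->
        max_ideal P (d (f * g) - (f * d g + g * d f)) &
      forall c, max_ideal P (d (iota c))].

(* Omega_{X/k} (x) kappa(P) is a line: by duality, it is spanned by some dt <> 0. *)
Definition smooth_at P : Prop :=
  exists t, [/\ local_ring P t,
    forall d, residue_derivation P d -> max_ideal P (d t) ->
      forall f, local_ring P f -> max_ideal P (d f) &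
    exists2 d, residue_derivation P d & ~ max_ideal P (d t)].

Definition smooth_curve : Prop :=
  [/\ one_variable_function_field, full_constant_field & forall P, smooth_at P].

(* The genus h^1(X, O_X), as in Riemann's theorem: the maximum over all divisors A
   of deg A + 1 - h^0(A). *)
Definition is_genus (g : nat) : Prop :=
  let h0 A := (quot_dim (sections A) [set 0])%:Z in
  (forall A : place iota -> int, is_divisor A -> deg A + 1 - h0 A <= g%:Z) /\
  (exists2 A : place iota -> int, is_divisor A & deg A + 1 - h0 A = g%:Z).

Definition derivation (D : F -> F) : Prop :=
  [/\ forall f g, D (f + g) = D f + D g,
      forall f g, D (f * g) = f * D g + g * D f &
      forall c, D (iota c) = 0].

(* K is the divisor of a nonzero rational differential w.  Omega_{F/k} is a line,
   and w is given by the derivation D dual to it, so that df = (D f) w.  Then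
   Omega_{O_P/k} is the O_P-module generated by the (D f) w for f in O_P, and
   ord_P(w) is minus the least valuation of D f for f in O_P. *)
Definition canonical_divisor (K : place iota -> int) : Prop :=
  is_divisor K /\
  exists D, [/\ derivation D, exists f, D f != 0 &
    forall P,
      (forall f, local_ring P f -> D f != 0 -> - K P <= P (D f)) /\
      (exists f, [/\ local_ring P f, D f != 0 & P (D f) = - K P])].

(* kappa(P) is separable over k. *)
Definition separable_point P : Prop :=
  forall f, local_ring P f ->
    exists2 p : {poly k}, separable_poly p & max_ideal P (map_poly iota p).[f].

(* stab_order P is the order of the stabilizer above P, so P is nonstacky iff it
   is 1; log_pts is the set of points whose sum is Delta. *)
Record log_stacky_curve := LogStackyCurve {
  coarse_smooth : smooth_curve;
  stab_order : place iota -> nat;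
  stab_order_gt0 : forall P, (0 < stab_order P)%N;
  stacky_finite : finite_set [set P | stab_order P != 1%N];
  log_pts : set (place iota);
  log_pts_finite : finite_set log_pts;
  log_pts_nonstacky : forall P, log_pts P -> stab_order P = 1%N
}.

Variable X : log_stacky_curve.

Definition tame : Prop :=
  forall P p, p \in [pchar k] -> coprime (stab_order X P) p.

Definition separably_rooted : Prop :=
  forall P, stab_order X P != 1%N -> separable_point P.

(* The signature (g; e_1, ..., e_r; delta), for X separably rooted: the e_i are
   listed once for each geometric stacky point, and pt_degree P geometric points
   lie over a closed point P with separable residue field. *)
Definition has_signature (g : nat) (e : seq nat) (delta : nat) : Prop :=
  [/\ is_genus g,
      forall a, a \in e -> (2 <= a)%N,
      forall a, (2 <= a)%N ->
        count_mem a e = \sum_(P \in [set P | stab_order X P = a]) pt_degree P &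
      delta = \sum_(P \in log_pts X) pt_degree P].

(* The Q-divisor K_XX + Delta = K_X + sum_P (1 - 1/e_P) P + Delta on X. *)
Definition log_canonical (K : place iota -> int) : place iota -> rat := fun P =>
  (K P)%:~R + (1 - (stab_order X P)%:R^-1) + (`[< log_pts X P >])%:R.

End Curve.

Section CanonicalRing.
Variables (k F : fieldType) (iota : {rmorphism k -> F}).

Definition floor_mul (D : place iota -> rat) (d : nat) : place iota -> int :=
  fun P => Num.floor (d%:R * D P).

Definition Eff (D : place iota -> rat) : set nat :=
  [set d | 0 <= deg (floor_mul D d)].

(* The graded k-algebra of the H^0(X, |_ d D _|), d >= 0, realized inside F[T]
   with H^0(X, |_ d D _|) T^d in degree d. *)
Definition section_ring (D : place iota -> rat) : set {poly F} :=
  [set p | forall d, sections (floor_mul D d) p`_d].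

End CanonicalRing.

Definition is_saturation (M : set nat) (s : nat) : Prop :=
  (forall d, (s <= d)%N -> M d) /\
  (forall t, (forall d, (t <= d)%N -> M d) -> (s <= t)%N).

Definition ideal_gen (A : comNzRingType) (S : set A) : set A :=
  [set a | exists r : seq (A * A),
    (forall u, u \in r -> S u.2) /\ a = \sum_(u <- r) u.1 * u.2].

(* Homogeneous of degree d when the j-th variable has degree w j. *)
Definition weighted_homog (k : fieldType) n (w : 'I_n -> nat) (d : nat)
    (p : {mpoly k[n]}) : Prop :=
  forall m, m \in msupp p -> (\sum_j w j * m j)%N = d.

(* The graded subalgebra R of F[T] is isomorphic to k[x_1, ..., x_n] / I as a graded
   k-algebra, with 1 <= deg x_j <= N and I generated by homogeneous elements of
   degree at most M; x_j is sent to y j T^(w j). *)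
Definition generated_with_relations (k F : fieldType) (iota : {rmorphism k -> F})
    (R : set {poly F}) (N M : nat) : Prop :=
  exists n (w : 'I_n -> nat) (y : 'I_n -> F),
    let phi (q : {mpoly k[n]}) : {poly F} :=
      mmap (fun c => (iota c)%:P) (fun j => y j *: 'X^(w j)) q in
    [/\ forall j, (1 <= w j <= N)%N,
        range phi = R &
        exists2 S : set {mpoly k[n]},
          (forall q, S q -> exists2 d, (d <= M)%N & weighted_homog w d q) &
          [set q | phi q = 0] = ideal_gen S].

(* Main.v *)
(* Riemann's inequality h^0(A) >= deg A + 1, which is what genus 0 means here,
   already controls the curve: H^0(0) is a finite-dimensional domain, hence k, so
   H^0(B) = 0 when deg B < 0 (multiply by H^0(-B), of dimension at least 2), and
   divisors of degree 0 are principal.  A closed point P of minimal degree has a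
   degree dividing all others, so every divisor of degree >= 0 is equivalent to
   some lP.  If x is a nonconstant element of H^0(P), comparing H^0(P)/k with the
   residue field of P gives H^0((n + l)P) = H^0(nP) + x^n H^0(lP).

   Since mD is integral of positive degree, floor(mD) is equivalent to some nP
   with n > 0, and 1, x^n yield a base-point-free pencil u, v in R_m.  It gives
   R_(m+j) = R_m R_j for j >= s, hence generation in degree at most m + s.  Modulo
   the relations of degree at most 2(m + s), everything in higher degree d is in
   u R_(d-m) + v R_(d-m), and the only syzygies of u and v are the Koszul ones. *)

Require Import Defs.
From mathcomp Require Import all_boot all_order all_algebra.
From mathcomp Require Import boolp classical_sets.
From mathcomp Require Import cardinality fsbigop mpoly.
From mathcomp Require Import ring zify.

Set Implicit Arguments.
Unset Strict Implicit.
Unset Printing Implicit Defensive.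

Import Order.TTheory GRing.Theory Num.Theory.

(** * Weighted-homogeneous polynomials *)

Section Homogeneous.
Variables (k : fieldType) (n : nat) (w : 'I_n -> nat).
Implicit Types (p q : {mpoly k[n]}) (mu nu : 'X_{1..n}) (d : nat).
Local Open Scope ring_scope.

Definition wdeg mu : nat := (\sum_j w j * mu j)%N.

Lemma wdegD mu nu : wdeg (mu + nu)%MM = (wdeg mu + wdeg nu)%N.
Proof.
by rewrite /wdeg -big_split; apply: eq_bigr => j _; rewrite mnmDE mulnDr.
Qed.

Lemma wdegU j : wdeg U_(j)%MM = w j.
Proof.
rewrite /wdeg (bigD1 j) //= mnm1E eqxx muln1 big1 ?addn0 // => i /negbTE ne.
by rewrite mnm1E eq_sym ne muln0.
Qed.

Lemma homog0 d : weighted_homog w d (0 : {mpoly k[n]}).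
Proof. by move=> mu; rewrite msupp0. Qed.

Lemma homogX mu : weighted_homog w (wdeg mu) ('X_[mu] : {mpoly k[n]}).
Proof. by move=> nu; rewrite msuppX inE => /eqP ->. Qed.

Lemma homogC c : weighted_homog w 0 (c%:MP_[n] : {mpoly k[n]}).
Proof.
move=> nu; rewrite msuppC; case: eqP => // _; rewrite inE => /eqP ->.
by apply: big1 => j _; rewrite mnm0E muln0.
Qed.

Lemma homogD d p q :
  weighted_homog w d p -> weighted_homog w d q -> weighted_homog w d (p + q).
Proof. by move=> hp hq mu /msuppD_le; rewrite mem_cat => /orP[/hp|/hq]. Qed.

Lemma homogZ d c p : weighted_homog w d p -> weighted_homog w d (c *: p).
Proof. by move=> hp mu /msuppZ_le /hp. Qed.

Lemma homogB d p q :
  weighted_homog w d p -> weighted_homog w d q -> weighted_homog w d (p - q).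
Proof. by move=> hp hq; rewrite -scaleN1r; apply/homogD/homogZ. Qed.

Lemma homogM d d' p q :
  weighted_homog w d p -> weighted_homog w d' q ->
  weighted_homog w (d + d') (p * q).
Proof.
move=> hp hq mu /msuppM_le /allpairsP[[a b] /= [/hp ha /hq hb ->]].
by rewrite -[LHS]/(wdeg _) wdegD /wdeg ha hb.
Qed.

Lemma homog_sum d (I : eqType) (r : seq I) (G : I -> {mpoly k[n]}) :
  (forall i, i \in r -> weighted_homog w d (G i)) ->
  weighted_homog w d (\sum_(i <- r) G i).
Proof.
move=> hG; rewrite big_seq; apply: big_ind => //; first exact: homog0.
by move=> *; apply: homogD.
Qed.

Definition homog_part d p : {mpoly k[n]} :=
  \sum_(mu <- msupp p | wdeg mu == d) p@_mu *: 'X_[mu].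

Lemma homog_partP d p : weighted_homog w d (homog_part d p).
Proof.
rewrite /homog_part -big_filter; apply: homog_sum => mu.
by rewrite mem_filter => /andP[/eqP <- _]; apply/homogZ/homogX.
Qed.

Lemma homog_part_sum p :
  p = \sum_(d < (\max_(mu <- msupp p) wdeg mu).+1) homog_part d p.
Proof.
rewrite {1}[p]mpolyE; under [RHS]eq_bigr => d _ do rewrite /homog_part.
rewrite (exchange_big_dep xpredT) //= [LHS]big_seq [RHS]big_seq.
apply: eq_bigr => mu hmu.
have lt : (wdeg mu < (\max_(mu <- msupp p) wdeg mu).+1)%N.
  by rewrite ltnS leq_bigmax_seq.
by rewrite (big_pred1 (Ordinal lt)) // => d; rewrite eq_sym.
Qed.

(** Removing one variable lowers the weight by at most [N], so the weight cannot jump over the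
    interval from [N] (excluded) to [2 * N]. This bounds the degree of the relation needed to
    rewrite a large monomial. *)
Lemma submonomial N mu : (forall j, (1 <= w j <= N)%N) -> (N < wdeg mu)%N ->
  exists nu rho, mu = (nu + rho)%MM /\ (N < wdeg nu <= 2 * N)%N.
Proof.
move=> hw; elim: {mu}(mdeg mu) {-2}mu (erefl (mdeg mu)) => [|t IH] mu.
  by move/eqP; rewrite mdeg_eq0 => /eqP -> ; rewrite /wdeg big1 // => j _;
    rewrite mnm0E muln0.
move=> hmu hN; case: (leqP (wdeg mu) (2 * N)) => hle.
  by exists mu, 0%MM; rewrite addm0 hN hle.
have [j hj] : exists j, (0 < mu j)%N.
  apply/existsP; apply: contraTT hN; rewrite negb_exists => /forallP h0.
  rewrite -leqNgt /wdeg big1 // => j _.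
  by move: (h0 j); rewrite -leqNgt leqn0 => /eqP ->; rewrite muln0.
have hle1 : (U_(j) <= mu)%MM.
  by apply/mnm_lepP => i; rewrite mnm1E; case: eqP => // <-.
have e1 := submK hle1.
have /andP[_ wjN] := hw j.
have [] := IH (mu - U_(j))%MM.
- by move: (congr1 (@mdeg n) e1); rewrite mdegD mdeg1 addn1 hmu => -[].
- by move: (congr1 wdeg e1); rewrite wdegD wdegU; lia.
move=> nu [rho [e2 h]]; exists nu, (rho + U_(j))%MM; split => //.
by rewrite addmA -e2 e1.
Qed.

End Homogeneous.

(** * Ideals generated by a set *)

Section IdealGen.
Variables (A : comNzRingType) (S : set A).
Local Open Scope ring_scope.

Lemma ideal_gen0 : ideal_gen S 0.
Proof. by exists [::]; split => //; rewrite big_nil. Qed.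

Lemma ideal_gen_sub a : S a -> ideal_gen S a.
Proof.
move=> Sa; exists [:: (1, a)]; split; last by rewrite big_seq1 mul1r.
by move=> u; rewrite inE => /eqP ->.
Qed.

Lemma ideal_genD a b : ideal_gen S a -> ideal_gen S b -> ideal_gen S (a + b).
Proof.
move=> [r [hr ->]] [t [ht ->]]; exists (r ++ t); rewrite big_cat; split => // u.
by rewrite mem_cat => /orP[/hr|/ht].
Qed.

Lemma ideal_genM a b : ideal_gen S b -> ideal_gen S (a * b).
Proof.
move=> [r [hr ->]]; exists [seq (a * u.1, u.2) | u <- r]; split.
  by move=> _ /mapP[u /hr ? ->].
by rewrite big_map mulr_sumr; apply: eq_bigr => u _; rewrite mulrA.
Qed.

End IdealGen.

(** * Presentations of graded rings that contain a suitable pencil *)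

Section Presentation.
Variables (k F : fieldType) (iota : {rmorphism k -> F}).
Variables (R : nat -> set F).
Local Open Scope ring_scope.

Hypotheses (R0 : forall d, R d 0) (R1 : R 0 1)
  (RD : forall d f g, R d f -> R d g -> R d (f + g))
  (RZ : forall d c f, R d f -> R d (iota c * f))
  (RM : forall d d' f g, R d f -> R d' g -> R (d + d') (f * g))
  (Rconst : forall f, R 0 f -> exists c, f = iota c).

Lemma graded_sum d (I : Type) (r : seq I) (G : I -> F) :
  (forall i, R d (G i)) -> R d (\sum_(i <- r) G i).
Proof. by move=> hG; apply: big_ind => //; apply: RD. Qed.

Variables (m s : nat) (u v : F).
Hypotheses (m_gt0 : (0 < m)%N) (Ru : R m u) (Rv : R m v).
(** In particular R_(m+j) is spanned by products from R_m and R_j. [Rpencil] is the analogue for j =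
    m with [c] equal to [u], and [Rsyzygy] is exactness in the middle of the Koszul complex of [u]
    and [v]. *)
Hypothesis Rstep : forall j f, (s <= j)%N -> R (m + j) f ->
  exists c al be, [/\ R j c, R m al, R j be & f = al * c + v * be].
Hypothesis Rpencil : forall f, R (m + m) f ->
  exists al be, [/\ R m al, R m be & f = u * al + v * be].
Hypothesis Rsyzygy : forall d al be, R (m + d) al -> R (m + d) be ->
  u * al + v * be = 0 -> exists ga, [/\ R d ga, al = v * ga & be = - u * ga].

Local Notation N := (m + s)%N.

(** * Image and kernel of the presentation map *)

Section Generators.
Variables (n : nat) (w : 'I_n -> nat) (y : 'I_n -> F).
Hypotheses (w_bound : forall j, (1 <= w j <= N)%N) (Ry : forall j, R (w j) (y j)).
Hypothesis y_span : forall d f, (1 <= d <= N)%N -> R d f ->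
  exists t (a : 'I_t -> 'I_n) (c : 'I_t -> k),
    (forall i, w (a i) = d) /\ f = \sum_i iota (c i) * y (a i).

Let phi (q : {mpoly k[n]}) : {poly F} :=
  mmap (polyC \o iota) (fun j => y j *: 'X^(w j)) q.
Local Notation whomog := (weighted_homog w).

Let phiB p q : phi (p - q) = phi p - phi q. Proof. exact: rmorphB. Qed.
Let phiD p q : phi (p + q) = phi p + phi q. Proof. exact: rmorphD. Qed.
Let phiM p q : phi (p * q) = phi p * phi q. Proof. exact: rmorphM. Qed.
Let phi_sum (I : Type) (r : seq I) (G : I -> {mpoly k[n]}) :
  phi (\sum_(i <- r) G i) = \sum_(i <- r) phi (G i).
Proof. exact: rmorph_sum. Qed.
Let phiZ c p : phi (c *: p) = iota c *: phi p.
Proof. by rewrite /phi mmapZ /= mul_polyC. Qed.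
Let phiC c : phi c%:MP = (iota c)%:P. Proof. exact: mmapC. Qed.
Let phiU j : phi 'X_j = y j *: 'X^(w j). Proof. by rewrite /phi mmapX mmap1U. Qed.

Let phi_mul i j d A C al c : d = (i + j)%N ->
  phi A = al *: 'X^i -> phi C = c *: 'X^j -> phi (A * C) = (al * c) *: 'X^d.
Proof.
by move=> -> eA eC; rewrite phiM eA eC -scalerAl -scalerAr scalerA exprD.
Qed.

Let phi_comb i j d A C V B al c b be : d = (i + j)%N ->
  phi A = al *: 'X^i -> phi C = c *: 'X^j -> phi V = b *: 'X^i ->
  phi B = be *: 'X^j -> phi (A * C + V * B) = (al * c + b * be) *: 'X^d.
Proof.
by move=> e eA eC eV eB; rewrite phiD (phi_mul e eA eC) (phi_mul e eV eB) scalerDl.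
Qed.

Lemma phi_monomial mu : exists2 f, R (wdeg w mu) f & phi 'X_[mu] = f *: 'X^(wdeg w mu).
Proof.
have hpow j e : R (w j * e) (y j ^+ e).
  elim: e => [|e IH]; first by rewrite muln0 expr0.
  by rewrite mulnS exprS; apply: RM.
rewrite /phi mmapX /mmap1 /wdeg.
elim/big_rec2: _ => [|j d p _ [f Rf ->]]; first by exists 1; rewrite ?scale1r ?expr0.
exists (y j ^+ mu j * f); first exact: RM.
by rewrite exprZn -exprM -scalerAl -scalerAr scalerA exprD.
Qed.

Lemma phi_homog d q : whomog d q -> exists2 f, R d f & phi q = f *: 'X^d.
Proof.
move=> hq; rewrite [q]mpolyE phi_sum big_seq.
apply: (big_ind (fun p => exists2 f, R d f & p = f *: 'X^d)).
- by exists 0; rewrite ?scale0r.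
- move=> _ _ [f Rf ->] [g Rg ->]; exists (f + g); first exact: RD.
  by rewrite scalerDl.
- move=> mu /hq <-; have [f Rf e] := phi_monomial mu.
  by exists (iota q@_mu * f); [exact: RZ | rewrite phiZ e scalerA].
Qed.

(** In degree above [N], [Rstep] with j = d - m expresses [f] through elements of degrees m and d -
    m, both smaller than d because 0 < m < d; strong induction lifts each of them. *)
Lemma homog_lift d f : R d f -> exists2 q, whomog d q & phi q = f *: 'X^d.
Proof.
elim/ltn_ind: d f => d IH f Rf; case: (posnP d) => [d0|d_gt0].
  move: Rf; rewrite d0 => /Rconst[c ->]; exists c%:MP; first exact: homogC.
  by rewrite phiC expr0 alg_polyC.
case: (leqP d N) => hd.
  have [t [a [c [ha ->]]]] : exists t (a : 'I_t -> 'I_n) (c : 'I_t -> k),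
    (forall i, w (a i) = d) /\ f = \sum_i iota (c i) * y (a i).
    by apply: y_span; rewrite // d_gt0.
  exists (\sum_i c i *: 'X_(a i)).
    apply: homog_sum => i _; apply: homogZ.
    by rewrite -(ha i) -(wdegU w); apply: homogX.
  rewrite phi_sum scaler_suml; apply: eq_bigr => i _.
  by rewrite phiZ phiU ha scalerA.
have e : d = (m + (d - m))%N by lia.
rewrite e in Rf.
have [||c [al [be [Rc Ral Rbe ->]]]] := @Rstep (d - m) f; [lia|exact: Rf|].
have [C hC eC] : exists2 q, whomog (d - m) q & phi q = c *: 'X^(d - m).
  by apply: IH => //; lia.
have [B hB eB] : exists2 q, whomog (d - m) q & phi q = be *: 'X^(d - m).
  by apply: IH => //; lia.
have [A hA eA] : exists2 q, whomog m q & phi q = al *: 'X^m.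
  by apply: IH => //; lia.
have [V hV eV] : exists2 q, whomog m q & phi q = v *: 'X^m.
  by apply: IH => //; lia.
exists (A * C + V * B).
  by rewrite e; apply: homogD; apply: homogM.
exact: phi_comb e eA eC eV eB.
Qed.

(** Taking every homogeneous relation within the bound as a generator leaves one substantial
    inclusion: the kernel lies in this ideal. *)
Let Rel : set {mpoly k[n]} :=
  [set q | exists d, [/\ (d <= 2 * N)%N, whomog d q & phi q = 0]].
Local Notation J := (ideal_gen Rel).

Let J_add p q : J p -> J q -> J (p + q). Proof. exact: ideal_genD. Qed.
Let J_mul p q : J q -> J (p * q). Proof. exact: ideal_genM. Qed.

Lemma ideal_gen_phi q : J q -> phi q = 0.
Proof.
move=> [r [hr ->]]; rewrite phi_sum big_seq big1 // => x /hr[d [_ _ h]].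
by rewrite phiM h mulr0.
Qed.

Let polyXI d (f g : F) : f *: 'X^d = g *: 'X^d -> f = g.
Proof. by move=> /polyP/(_ d); rewrite !coefZ !coefXn eqxx !mulr1. Qed.

(* In degree [d], the quotient by the relations of degree at most [2N] is
   spanned by the multiples of [U] and [V]; the two-term Koszul complex then
   accounts for all the remaining relations. *)
Lemma homog_ker_in_ideal d q : whomog d q -> phi q = 0 -> J q.
Proof.
have [U hU eU] := homog_lift Ru; have [V hV eV] := homog_lift Rv.
elim/ltn_ind: d q => d IH q hq q0.
case: (leqP d (2 * N)) => hd; first by apply: ideal_gen_sub; exists d.
have IHeq d' p p' : (d' < d)%N -> whomog d' p -> whomog d' p' -> phi p = phi p' ->
    J (p - p').
  move=> lt hp hp' e; apply: (IH d') => //; first exact: homogB.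
  by rewrite phiB e subrr.
(* [E] is stable under sums, scalars and congruence modulo J, so it will suffice to prove it for
   monomials of weight d. *)
pose E p := exists Q1 Q2, [/\ whomog (d - m) Q1, whomog (d - m) Q2 &
  J (p - (U * Q1 + V * Q2))].
have E0 : E 0.
  exists 0, 0; split; [exact: homog0|exact: homog0|].
  by rewrite !mulr0 addr0 subr0; apply: ideal_gen0.
have ED p p' : E p -> E p' -> E (p + p').
  move=> [Q1 [Q2 [h1 h2 hJ]]] [Q1' [Q2' [h1' h2' hJ']]].
  exists (Q1 + Q1'), (Q2 + Q2'); split; try exact: homogD.
  have -> : p + p' - (U * (Q1 + Q1') + V * (Q2 + Q2')) =
    (p - (U * Q1 + V * Q2)) + (p' - (U * Q1' + V * Q2')) by ring.
  exact: J_add.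
have EJ p p' : E p -> J (p' - p) -> E p'.
  move=> [Q1 [Q2 [h1 h2 hJ]]] hp; exists Q1, Q2; split => //.
  have -> : p' - (U * Q1 + V * Q2) = (p' - p) + (p - (U * Q1 + V * Q2)) by ring.
  exact: J_add.
have EZ c p : E p -> E (c *: p).
  move=> [Q1 [Q2 [h1 h2 hJ]]]; exists (c *: Q1), (c *: Q2).
  split; try exact: homogZ.
  by rewrite -!scalerAr -scalerDr -scalerBr -mul_mpolyC; apply: J_mul.
have EV p : whomog (d - m) p -> E (V * p).
  move=> hp; exists 0, p; split; [exact: homog0|by []|].
  by rewrite mulr0 add0r subrr; apply: ideal_gen0.
have EU p : whomog (d - m) p -> E (U * p).
  move=> hp; exists p, 0; split; [by []|exact: homog0|].
  by rewrite mulr0 addr0 subrr; apply: ideal_gen0.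
(* Modulo J, [Q] is rewritten as A' C + V B by induction in degree d - m, then the product A A' by
   [Rpencil] in degree 2m; both degrees are below d. *)
have EM A Q : whomog m A -> whomog (d - m) Q -> E (A * Q).
  move=> hA hQ; have [g Rg eg] := phi_homog hQ.
  have e : (d - m = m + (d - 2 * m))%N by lia.
  have [||c [al [be [Rc Ral Rbe eg']]]] := @Rstep (d - 2 * m) g.
  - lia.
  - by rewrite -e.
  have [C hC eC] := homog_lift Rc; have [B hB eB] := homog_lift Rbe.
  have [A' hA' eA'] := homog_lift Ral.
  have hQ' : J (Q - (A' * C + V * B)).
    apply: (IHeq (d - m)%N) => //; first by lia.
      by rewrite e; apply: homogD; apply: homogM.
    by rewrite eg eg'; symmetry; apply: phi_comb e eA' eC eV eB.
  have hAA := homogM hA hA'; have [f Rf ef] := phi_homog hAA.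
  have [a [b [Ra Rb ef']]] := Rpencil Rf.
  have [A1 h1 e1] := homog_lift Ra; have [A2 h2 e2] := homog_lift Rb.
  have hAA' : J (A * A' - (U * A1 + V * A2)).
    apply: (IHeq (m + m)%N) => //; first by lia.
      by apply: homogD; apply: homogM.
    by rewrite ef ef'; symmetry; apply: phi_comb eU e1 eV e2.
  apply: (EJ (U * (A1 * C) + V * (A2 * C + A * B))).
    by apply: ED; [apply: EU|apply: EV; apply: homogD]; rewrite e; apply: homogM.
  have -> : A * Q - (U * (A1 * C) + V * (A2 * C + A * B)) =
    A * (Q - (A' * C + V * B)) + C * (A * A' - (U * A1 + V * A2)) by ring.
  by apply: J_add; apply: J_mul.
(* A factor of weight in the range of [submonomial] is rewritten by a relation of degree at most
   [2 * N]; its weight exceeds m + s, so [Rstep] applies. *)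
have EX mu : wdeg w mu = d -> E 'X_[mu].
  move=> hmu.
  have [|nu [rho [emu /andP[lo hi]]]] := submonomial (mu := mu) w_bound.
    by rewrite hmu; lia.
  have [f Rf ef] := phi_monomial nu.
  have e : (wdeg w nu = m + (wdeg w nu - m))%N by lia.
  have e' : (d - m = (wdeg w nu - m) + wdeg w rho)%N.
    by rewrite -hmu emu wdegD; lia.
  have [||c [al [be [Rc Ral Rbe ef']]]] := @Rstep (wdeg w nu - m) f.
  - lia.
  - by rewrite -e.
  have [C hC eC] := homog_lift Rc; have [B hB eB] := homog_lift Rbe.
  have [A hA eA] := homog_lift Ral.
  have hnu : J ('X_[nu] - (A * C + V * B)).
    apply: ideal_gen_sub; exists (wdeg w nu); split => //.
      apply: homogB; first exact: homogX.
      by rewrite e; apply: homogD; apply: homogM.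
    by rewrite phiB ef ef' (phi_comb e eA eC eV eB) subrr.
  apply: (EJ (A * (C * 'X_[rho]) + V * (B * 'X_[rho]))).
    by apply: ED; [apply: EM|apply: EV] => //; rewrite e'; apply: homogM => //;
      apply: homogX.
  rewrite emu mpolyXD.
  have -> : 'X_[nu] * 'X_[rho] - (A * (C * 'X_[rho]) + V * (B * 'X_[rho])) =
    'X_[rho] * ('X_[nu] - (A * C + V * B)) by ring.
  exact: J_mul.
have [Q1 [Q2 [h1 h2 hJ]]] : E q.
  rewrite [q]mpolyE big_seq; apply: (big_ind E) => // mu /hq hmu.
  by apply/EZ/EX.
have [al Ral eal] := phi_homog h1; have [be Rbe ebe] := phi_homog h2.
have e : (d - m = m + (d - 2 * m))%N by lia.
(* [phi] kills [q] and J, so the images of [Q1] and [Q2] form a syzygy of [u] and [v]. *)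
have [||| ga [Rga ega1 ega2]] := @Rsyzygy (d - 2 * m) al be.
- by rewrite -e.
- by rewrite -e.
- apply: (@polyXI d); rewrite scale0r; have := ideal_gen_phi hJ.
  rewrite phiB q0 sub0r => /eqP; rewrite oppr_eq0 => /eqP <-.
  by symmetry; apply: phi_comb eU eal eV ebe; lia.
have [G hG eG] := homog_lift Rga.
(* Once [ga] is lifted to [G], both corrected coefficients lie in the kernel in degree d - m < d. *)
have hJ1 : J (Q1 - V * G).
  apply: (IHeq (d - m)%N) => //; first by lia.
    by rewrite e; apply: homogM.
  by rewrite eal ega1; symmetry; apply: phi_mul e eV eG.
have hJ2 : J (Q2 - (- 1 *: U) * G).
  apply: (IHeq (d - m)%N) => //; first by lia.
    by rewrite e; apply: homogM => //; apply: homogZ.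
  rewrite ebe ega2; symmetry; apply: (phi_mul e _ eG).
  by rewrite phiZ eU rmorphN rmorph1 scaleN1r scaleNr.
(* The Koszul terms U V G cancel. *)
have -> : q = (q - (U * Q1 + V * Q2)) +
    (U * (Q1 - V * G) + V * (Q2 - (-1 *: U) * G)).
  by rewrite scaleN1r; ring.
by apply: J_add => //; apply: J_add; apply: J_mul.
Qed.

(** [phi] respects the gradings, so the coefficient of T^d in [phi q] comes from the weight-d
    component alone, and each component lies in the kernel. *)
Lemma ker_in_ideal q : phi q = 0 -> J q.
Proof.
move=> q0; rewrite [q](homog_part_sum w).
apply: (big_ind (fun p => J p)); [exact: ideal_gen0|exact: J_add|].
move=> d _; apply: (homog_ker_in_ideal (homog_partP (w := w) (d := d) (p := q))).
have hc (e : nat) : exists2 f, R e f & phi (homog_part w e q) = f *: 'X^e.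
  exact/phi_homog/homog_partP.
have [f _ ef] := hc d; rewrite ef.
suff -> : f = 0 by rewrite scale0r.
have : (phi q)`_d = 0 by rewrite q0 coef0.
rewrite {1}(homog_part_sum w q) phi_sum coef_sum (bigD1 d) //= ef.
rewrite coefZ coefXn eqxx mulr1 big1 ?addr0 // => e /negbTE ne.
have [g _ ->] := hc e.
by rewrite coefZ coefXn -(inj_eq val_inj) in ne *; rewrite eq_sym ne mulr0.
Qed.

End Generators.

(** * Finite generation and the resulting presentation *)

Hypothesis Rfin : forall d, exists t (b : 'I_t -> F),
  (forall i, R d (b i)) /\
  forall f, R d f -> exists c : 'I_t -> k, f = \sum_i iota (c i) * b i.

(** Spanning families of the degrees 1 to [M] are concatenated; each generator carries its degree,
    since one element of [F] may lie in several R_d. *)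
Lemma graded_generators M : exists gens : seq (nat * F),
  (forall g, g \in gens -> (1 <= g.1 <= M)%N /\ R g.1 g.2) /\
  forall d f, (1 <= d <= M)%N -> R d f ->
    exists t (b : 'I_t -> F) (c : 'I_t -> k),
      (forall i, (d, b i) \in gens) /\ f = \sum_i iota (c i) * b i.
Proof.
elim: M => [|M [gens [h1 h2]]]; first by exists [::]; split=> // d f; case: d.
have [t [b [Rb hb]]] := Rfin M.+1.
exists (gens ++ [seq (M.+1, b i) | i <- enum 'I_t]); split.
  move=> g; rewrite mem_cat => /orP[/h1[/andP[-> /leqW ->]]|] //.
  by move=> /mapP[i _ ->] /=; rewrite leqnn.
move=> d f /andP[d_gt0]; rewrite leq_eqVlt => /orP[/eqP -> /hb[c ->]|].
  exists t, b, c; split => // i; rewrite mem_cat; apply/orP; right.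
  by apply/mapP; exists i; rewrite ?mem_enum.
rewrite ltnS => dM Rf; have [|t' [b' [c [hg ->]]]] := h2 d f _ Rf.
  by rewrite d_gt0.
by exists t', b', c; split => // i; rewrite mem_cat hg.
Qed.

Lemma graded_presentation :
  generated_with_relations iota [set p | forall d, R d p`_d] N (2 * N)%N.
Proof.
have [gens [h1 h2]] := graded_generators N.
pose w (j : 'I_(size gens)) := (nth (0%N, 0) gens j).1.
pose y (j : 'I_(size gens)) := (nth (0%N, 0) gens j).2.
have hw j : (1 <= w j <= N)%N by have [] := h1 _ (mem_nth (0%N, 0) (ltn_ord j)).
have hy j : R (w j) (y j) by have [] := h1 _ (mem_nth (0%N, 0) (ltn_ord j)).
have hspan d f : (1 <= d <= N)%N -> R d f ->
    exists t (a : 'I_t -> 'I_(size gens)) (c : 'I_t -> k),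
      (forall i, w (a i) = d) /\ f = \sum_i iota (c i) * y (a i).
  move=> hd /(h2 d f hd)[t [b [c [hb ->]]]].
  have hi i : (index (d, b i) gens < size gens)%N by rewrite index_mem.
  exists t, (fun i => Ordinal (hi i)), c; split=> [i|].
    by rewrite /w /= nth_index.
  by apply: eq_bigr => i _; rewrite /y /= nth_index.
exists (size gens), w, y => phi.
have phi_sum (I : Type) (r : seq I) (G : I -> {mpoly k[size gens]}) :
    phi (\sum_(i <- r) G i) = \sum_(i <- r) phi (G i).
  exact: (rmorph_sum (mmap (polyC \o iota) (fun j => y j *: 'X^(w j)))).
split => //.
  apply/seteqP; split=> [_ [q _ <-] d /=|p hp].
    rewrite (homog_part_sum w q) phi_sum coef_sum; apply: graded_sum => e.
    have [f Rf] := phi_homog hy (homog_partP (w := w) (d := e) (p := q)).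
    rewrite -[mmap _ _ _]/(phi _) => ->.
    by rewrite coefZ coefXn; case: eqP => [->|_]; rewrite ?mulr1 ?mulr0.
  have hlift (d : nat) : exists q, phi q = p`_d *: 'X^d.
    by have [q _ e] := homog_lift hspan (hp d); exists q.
  have [Q hQ] := choice hlift.
  exists (\sum_(d < size p) Q d) => //; rewrite phi_sum.
  by under eq_bigr => d _ do rewrite hQ; rewrite -poly_def coefK.
exists [set q | exists d, [/\ (d <= 2 * N)%N, weighted_homog w d q & phi q = 0]]%classic.
  by move=> q [d [? ? _]]; exists d.
apply/seteqP; split=> q /=.
  exact: (ker_in_ideal hw hy hspan).
exact: ideal_gen_phi.
Qed.

End Presentation.

(** * Valuations and spaces of sections *)

Section Places.
Variables (k F : fieldType) (iota : {rmorphism k -> F}).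
Implicit Types (P Q : place iota) (A B : place iota -> int) (f g : F).
Local Open Scope ring_scope.

Lemma place1 P : P 1 = 0.
Proof.
have := val_atM P (oner_neq0 F) (oner_neq0 F); rewrite mulr1; move: (P 1); lia.
Qed.

Lemma placeV P f : P f^-1 = - P f.
Proof.
have [->|f0] := eqVneq f 0; first by rewrite invr0 val_at0 oppr0.
have fV0 : f^-1 != 0 by rewrite invr_eq0.
by have := val_atM P f0 fV0; rewrite divff // place1 => h; lia.
Qed.

Lemma placeX P f n : f != 0 -> P (f ^+ n) = n%:Z * P f.
Proof.
move=> f0; elim: n => [|n IH]; first by rewrite expr0 place1 mul0r.
by rewrite exprS val_atM ?expf_neq0 // IH; lia.
Qed.

(* [P f >= n], with the convention that [P 0] is infinite *)
Definition val_ge P (n : int) f : Prop := f = 0 \/ n <= P f.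

Lemma val_ge0 P n : val_ge P n 0. Proof. by left. Qed.

Lemma val_geW P n n' f : n' <= n -> val_ge P n f -> val_ge P n' f.
Proof. by move=> le [->|h]; [left|right; apply: le_trans h]. Qed.

Lemma val_geD P n f g : val_ge P n f -> val_ge P n g -> val_ge P n (f + g).
Proof.
have [->|f0] := eqVneq f 0; first by rewrite add0r.
have [->|g0] := eqVneq g 0; first by rewrite addr0.
have [->|fg0] := eqVneq (f + g) 0; first by left.
move=> [/eqP|hf]; first by rewrite (negbTE f0).
move=> [/eqP|hg]; first by rewrite (negbTE g0).
by right; apply: le_trans (val_atD P f0 g0 fg0); rewrite le_min hf hg.
Qed.

Lemma val_geM P n n' f g :
  val_ge P n f -> val_ge P n' g -> val_ge P (n + n') (f * g).
Proof.
have [->|f0] := eqVneq f 0; first by rewrite mul0r; left.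
have [->|g0] := eqVneq g 0; first by rewrite mulr0; left.
move=> [/eqP|hf]; first by rewrite (negbTE f0).
move=> [/eqP|hg]; first by rewrite (negbTE g0).
by right; rewrite val_atM //; lia.
Qed.

Lemma val_ge_const P c : val_ge P 0 (iota c).
Proof.
have [->|c0] := eqVneq c 0; first by rewrite rmorph0; left.
by right; rewrite val_at_const.
Qed.

Lemma val_geZ P n c f : val_ge P n f -> val_ge P n (iota c * f).
Proof. by move=> h; rewrite -[n]add0r; apply: val_geM => //; apply: val_ge_const. Qed.

Lemma val_geN P n f : val_ge P n f -> val_ge P n (- f).
Proof. by move=> /(val_geZ (- 1)); rewrite rmorphN rmorph1 mulN1r. Qed.

Lemma val_geB P n f g : val_ge P n f -> val_ge P n g -> val_ge P n (f - g).
Proof. by move=> hf hg; apply/val_geD/val_geN. Qed.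

Lemma val_ge_sum P n (I : Type) (r : seq I) (G : I -> F) :
  (forall i, val_ge P n (G i)) -> val_ge P n (\sum_(i <- r) G i).
Proof. by move=> hG; apply: big_ind => //; [apply: val_ge0|apply: val_geD]. Qed.

(** At [f = 0] this uses the convention that a place takes the value 0 there. *)
Lemma local_ringE P f : local_ring P f <-> val_ge P 0 f.
Proof.
by split=> [|[->|//]]; [right|rewrite /local_ring /= val_at0].
Qed.

Lemma max_idealE P f : max_ideal P f <-> val_ge P 1 f.
Proof. by []. Qed.

Lemma sectionsE A f : sections A f <-> forall P, val_ge P (- A P) f.
Proof.
split=> [[->|h] P|h]; [by left|right; have := h P; lia|].
have [->|f0] := eqVneq f 0; [by left|right=> P].
by case: (h P) => [/eqP|]; [rewrite (negbTE f0)|lia].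
Qed.

Lemma sections0 A : sections A (0 : F). Proof. by left. Qed.

Lemma sectionsD A f g : sections A f -> sections A g -> sections A (f + g).
Proof.
by move=> /sectionsE hf /sectionsE hg; apply/sectionsE => P; apply: val_geD.
Qed.

Lemma sectionsZ A c f : sections A f -> sections A (iota c * f).
Proof. by move=> /sectionsE hf; apply/sectionsE => P; apply: val_geZ. Qed.

Lemma sectionsW A B f : (forall P, A P <= B P) -> sections A f -> sections B f.
Proof.
move=> le /sectionsE hf; apply/sectionsE => P; apply: val_geW (hf P).
by rewrite lerN2.
Qed.

Lemma sectionsM A B f g :
  sections A f -> sections B g -> sections (fun P => A P + B P) (f * g).
Proof.
move=> /sectionsE hf /sectionsE hg; apply/sectionsE => P.
by rewrite opprD; apply: val_geM.
Qed.

(** With B = A - div c this transports sections along a linear equivalence. *)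
Lemma sections_shift A B c f : c != 0 -> (forall Q, A Q - Q c <= B Q) ->
  sections A f -> sections B (c * f).
Proof.
move=> c0 le /sectionsE hf; apply/sectionsE => Q.
apply: (@val_geW _ (Q c - A Q)); first by have := le Q; lia.
by apply: val_geM => //; right.
Qed.

Lemma sections_sum A (I : Type) (r : seq I) (G : I -> F) :
  (forall i, sections A (G i)) -> sections A (\sum_(i <- r) G i).
Proof. by move=> hG; apply: big_ind => //; [apply: sections0|apply: sectionsD]. Qed.

Lemma sections1 : sections (fun _ : place iota => 0) 1.
Proof. by right=> P; rewrite place1. Qed.

Definition point_div P (n : int) : place iota -> int :=
  fun Q => if Q == P then n else 0.

(** * Additivity of the degree *)

Section Degree.
Local Open Scope classical_set_scope.

(** Lets the degrees of several divisors be computed over one common set. *)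
Lemma deg_supp (G : zmodType) (A : place iota -> G) (S : set (place iota)) :
  (forall P, ~ S P -> A P = 0) -> deg A = \sum_(P \in S) A P *+ pt_degree P.
Proof.
move=> h; symmetry; apply: fsbig_widen => // P [_ nS] /=.
by rewrite h // mul0rn.
Qed.

Lemma is_divisor_sub (G H : zmodType) (A : place iota -> G) (B : place iota -> H) :
  (forall P, B P = 0 -> A P = 0) -> is_divisor B -> is_divisor A.
Proof.
move=> h; apply: sub_finite_set => P /=; apply: contra_neq; exact: h.
Qed.

Lemma is_divisorD (G : zmodType) (A B : place iota -> G) :
  is_divisor A -> is_divisor B -> is_divisor (fun P => A P + B P).
Proof.
move=> hA hB; have : finite_set ([set P | A P != 0] `|` [set P | B P != 0]).
  by rewrite finite_setU.
apply: sub_finite_set => P /=; have [->|? _] := eqVneq (A P) 0; last by left.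
by rewrite add0r; right.
Qed.

Lemma is_divisorN (G : zmodType) (A : place iota -> G) :
  is_divisor A -> is_divisor (fun P => - A P).
Proof. by apply: is_divisor_sub => P ->; rewrite oppr0. Qed.

Lemma is_divisor_point P n : is_divisor (point_div P n).
Proof.
apply: (sub_finite_set _ (finite_set1 P)) => Q /=.
by rewrite /point_div; case: (Q =P P) => // _; rewrite eqxx.
Qed.

Lemma degD (G : zmodType) (A B : place iota -> G) :
  is_divisor A -> is_divisor B -> deg (fun P => A P + B P) = deg A + deg B.
Proof.
move=> hA hB; pose S := [set P | A P != 0] `|` [set P | B P != 0].
have hS : finite_set S by rewrite finite_setU.
have nA P : ~ S P -> A P = 0 by move=> n; apply: contra_notP n => /eqP ?; left.
have nB P : ~ S P -> B P = 0 by move=> n; apply: contra_notP n => /eqP ?; right.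
rewrite (deg_supp nA) (deg_supp nB) (@deg_supp _ _ S); last first.
  by move=> P n; rewrite nA // nB // addr0.
by rewrite -fsbig_split //=; apply: eq_fsbigr => P _; rewrite mulrnDl.
Qed.

Lemma deg0 (G : zmodType) : deg (fun _ : place iota => 0 : G) = 0.
Proof. by rewrite /deg fsbig1 // => P _; rewrite mul0rn. Qed.

Lemma degN (G : zmodType) (A : place iota -> G) :
  is_divisor A -> deg (fun P => - A P) = - deg A.
Proof.
move=> hA; apply/eqP; rewrite -addr_eq0 -degD //; last exact: is_divisorN.
by under eq_fun do rewrite addNr; rewrite deg0.
Qed.

Lemma deg_point P n : deg (point_div P n) = n * (pt_degree P)%:Z.
Proof.
rewrite (@deg_supp _ _ [set P]) ?fsbig_set1 /point_div ?eqxx.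
  by rewrite -mulr_natr natz.
by move=> Q; case: eqP => // ->.
Qed.

Lemma deg_intr (A : place iota -> int) :
  is_divisor A -> deg (fun P => (A P)%:~R : rat) = (deg A)%:~R.
Proof.
move=> hA; pose S := [set P | A P != 0].
have nA P : ~ S P -> A P = 0 by move=> n; apply: contra_notP n => /eqP.
rewrite (deg_supp nA) (@deg_supp _ _ S); last by move=> P /nA ->.
rewrite !fsbig_finite // rmorph_sum.
by apply: eq_bigr => P _; rewrite rmorphMn.
Qed.

Lemma deg_scale (a : rat) (A : place iota -> rat) :
  deg (fun P => a * A P) = a * deg A.
Proof.
by rewrite /deg mulr_fsumr; apply: eq_fsbigr => P _; rewrite mulrnAr.
Qed.

End Degree.
End Places.

(** * Genus zero: consequences of Riemann's inequality *)

Section GenusZero.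
Variables (k F : fieldType) (iota : {rmorphism k -> F}).
Implicit Types (P Q : place iota) (A B : place iota -> int) (f g : F).
Local Open Scope ring_scope.

(** The coefficient matrix has more rows than columns, so its left kernel contains a nonzero row. *)
Lemma linear_dependence (m n : nat) (f : 'I_m -> F) (b : 'I_n -> F) :
  (forall i, exists c : 'I_n -> k, f i = \sum_j iota (c j) * b j) -> (n < m)%N ->
  exists2 r : 'rV[k]_m, r != 0 & \sum_i iota (r 0 i) * f i = 0.
Proof.
move=> hf ltnm; have [c hc] := choice hf.
pose M := \matrix_(i < m, j < n) c i j.
have ker0 : kermx M != 0.
  by rewrite -mxrank_eq0 mxrank_ker; have := rank_leq_col M; lia.
exists (nz_row (kermx M)); first by rewrite nz_row_eq0.
set r := nz_row _; have /sub_kermxP rM : (r <= kermx M)%MS by exact: nz_row_sub.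
under eq_bigr => i _ do rewrite hc mulr_sumr.
rewrite exchange_big big1 //= => j _.
transitivity (iota ((r *m M) 0 j) * b j); last by rewrite rM mxE rmorph0 mul0r.
rewrite mxE rmorph_sum mulr_suml; apply: eq_bigr => i _.
by rewrite rmorphM mulrA mxE.
Qed.

(** A positive value excludes the default 0 of [xget], so it is attained by an actual basis. *)
Lemma quot_dimP (V W : set F) :
  (0 < quot_dim iota V W)%N -> has_quot_dim iota V W (quot_dim iota V W).
Proof. by rewrite /quot_dim; case: xgetP => [n -> //|_]; rewrite ltnn. Qed.

Hypothesis const_field : full_constant_field iota.
Hypothesis genus0 : is_genus iota 0.

Let riemann A : is_divisor A ->
  deg A + 1 <= (quot_dim iota (sections A) [set 0%R]%classic)%:Z.
Proof. by move=> /(genus0.1 A); lia. Qed.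

(** Riemann's inequality makes the dimension at least 1, which excludes the default value;
    uniqueness of coordinates at 0 gives independence. *)
Lemma sections_basis A : is_divisor A -> 0 <= deg A ->
  exists N (b : 'I_N -> F), [/\ deg A + 1 <= N%:Z, forall i, sections A (b i),
    forall f, sections A f -> exists c : 'I_N -> k, f = \sum_i iota (c i) * b i &
    forall c : 'I_N -> k, \sum_i iota (c i) * b i = 0 -> forall i, c i = 0].
Proof.
move=> hA degA; have hdim := riemann hA.
have [|b [hb uniq_b]] := @quot_dimP (sections A) [set 0%R]%classic.
  by move: hdim; set q := quot_dim _ _ _; lia.
exists (quot_dim iota (sections A) [set 0%R]%classic), b; split=> // [f Af|c c0 i].
  have [c [/eqP hc _]] := uniq_b f Af; exists c.
  by move: hc; rewrite subr_eq0 => /eqP.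
have [z [_ uniq_z]] := uniq_b 0 (@sections0 _ _ _ A).
have e1 : z = [ffun i => c i].
  apply: uniq_z; rewrite /= sub0r; apply/eqP; rewrite oppr_eq0; apply/eqP.
  by rewrite -[RHS]c0; apply: eq_bigr => j _; rewrite ffunE.
have e2 : z = [ffun i => 0].
  apply: uniq_z; rewrite /= sub0r; apply/eqP; rewrite oppr_eq0; apply/eqP.
  by apply: big1 => j _; rewrite ffunE rmorph0 mul0r.
by move/ffunP/(_ i): (etrans (esym e1) e2); rewrite !ffunE.
Qed.

Lemma is_divisor0 : is_divisor (fun _ : place iota => 0 : int).
Proof.
by rewrite /is_divisor; apply: (sub_finite_set _ (finite_set0 _)) => P /=; rewrite ?eqxx.
Qed.

(** The N + 1 powers 1, f, ..., f^N lie in the N-dimensional space H^0(0), so [f] satisfies a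
    polynomial equation over k and is constant. *)
Lemma sections_0 f : sections (fun _ : place iota => 0) f -> exists c, f = iota c.
Proof.
move=> f0; have [|N [b [_ _ span _]]] := sections_basis is_divisor0.
  by rewrite deg0.
have [||r r0 hr] := @linear_dependence N.+1 N (fun i => f ^+ i) b.
- move=> i; apply: span; elim: (nat_of_ord i) => [|e IH]; first exact: sections1.
  rewrite exprS; apply: sectionsW (sectionsM f0 IH) => P; by rewrite addr0.
- by [].
apply: const_field; exists (rVpoly r).
  apply: contraNneq r0 => r0; apply/eqP/rowP => i.
  by rewrite -coef_rVpoly_ord r0 coef0 mxE.
rewrite /root (@horner_coef_wide _ N.+1); last first.
  by rewrite size_map_poly; apply: size_poly.
apply/eqP; rewrite -[RHS]hr; apply: eq_bigr => i _.
by rewrite coef_map coef_rVpoly_ord.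
Qed.

(** All [b i] lie on the line spanned by the inverse of [f], which holds at most one independent
    vector. *)
Lemma indep_not_const (N : nat) (b : 'I_N -> F) f :
  (forall c : 'I_N -> k, \sum_i iota (c i) * b i = 0 -> forall i, c i = 0) ->
  f != 0 -> (forall i, exists c, f * b i = iota c) -> (N <= 1)%N.
Proof.
move=> indep f0 hc; rewrite leqNgt; apply/negP => N1.
have [||r r0 hr] := @linear_dependence N 1 b (fun=> f^-1).
- move=> i; have [c e] := hc i; exists (fun=> c).
  by rewrite big_ord1 -e mulrAC divff // mul1r.
- by [].
move/eqP: r0; apply; apply/rowP => i; rewrite mxE.
exact: (indep (fun i => r 0 i) hr i).
Qed.

(** A nonzero [f] would multiply H^0(-A), of dimension at least 2, injectively into H^0(0) = k. *)
Lemma sections_neg A f : is_divisor A -> deg A < 0 -> sections A f -> f = 0.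
Proof.
move=> hA degA Af; apply/eqP; apply: contraTT isT => f0.
have [|N [b [hN hb _ indep]]] := sections_basis (is_divisorN hA).
  by rewrite degN //; lia.
suff : (N <= 1)%N by move: hN; rewrite degN //; lia.
apply: (indep_not_const indep f0) => i; apply: sections_0.
by apply: sectionsW (sectionsM Af (hb i)) => P; rewrite addrN.
Qed.

Lemma sections_neq0 A : is_divisor A -> 0 <= deg A -> exists2 f, f != 0 & sections A f.
Proof.
move=> hA degA; have [[|N] [b [hN hb _ indep]]] := sections_basis hA degA.
  by move: hN; lia.
exists (b ord0) => //; apply/eqP => b0.
have := indep (fun i => (i == ord0)%:R); rewrite big1 => [/(_ erefl ord0)/eqP|i _].
  by rewrite eqxx oner_eq0.
by case: eqP => [->|_]; rewrite ?b0 ?mulr0 // rmorph0 mul0r.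
Qed.

(** If the value were 0, the divisor -P would have degree 0 and a nonzero section; this is a
    constant, which cannot vanish at P. In particular the default 0 never occurs. *)
Lemma pt_degree_gt0 P : (0 < pt_degree P)%N.
Proof.
rewrite lt0n; apply/eqP => p0.
have [|f f0 hf] := sections_neq0 (is_divisor_point P (-1)).
  by rewrite deg_point p0.
have hf0 : sections (fun _ : place iota => 0) f.
  by apply: sectionsW hf => Q; rewrite /point_div; case: eqP.
have [c e] := sections_0 hf0; case: hf => [/eqP|/(_ P)]; first exact/negP.
have c0 : c != 0 by apply: contraNneq f0 => c0; rewrite e c0 rmorph0.
by rewrite e val_at_const // /point_div eqxx.
Qed.

(** Nonzero sections of A and of -A have a constant product, so the valuation inequalities of both
    are equalities. *)
Lemma deg0_principal A : is_divisor A -> deg A = 0 ->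
  exists2 c, c != 0 & forall Q, Q c = - A Q.
Proof.
move=> hA degA; have [|c c0 Ac] := sections_neq0 hA; first by rewrite degA.
have [|c' c'0 Ac'] := sections_neq0 (is_divisorN hA).
  by rewrite degN // degA.
exists c => // Q; have [a e] : exists a, c * c' = iota a.
  by apply: sections_0; apply: sectionsW (sectionsM Ac Ac') => P; rewrite addrN.
have a0 : a != 0.
  apply: contraTneq isT => a0; move/eqP: e.
  by rewrite a0 rmorph0 mulf_eq0 (negbTE c0) (negbTE c'0).
have := val_at_const Q a0; rewrite -e val_atM //.
case: Ac => [/eqP|/(_ Q)]; first by rewrite (negbTE c0).
case: Ac' => [/eqP|/(_ Q)]; first by rewrite (negbTE c'0).
move: (Q c) (Q c') (A Q); lia.
Qed.

(** H^0(P) has dimension at least 2, hence a nonconstant element; without a pole at P it would lie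
    in H^0(0) = k. *)
Lemma simple_pole P : exists x, P x = - 1 /\ forall Q, Q != P -> 0 <= Q x.
Proof.
have hP := is_divisor_point P 1.
have degP : deg (point_div P 1) = (pt_degree P)%:Z by rewrite deg_point mul1r.
have p0 := pt_degree_gt0 P.
have [|N [b [hN hb _ indep]]] := sections_basis hP; first by rewrite degP.
have [i hi] : exists i, ~ exists c, 1 * b i = iota c.
  apply/existsNP => h; have := indep_not_const indep (oner_neq0 F) h.
  by move: hN; rewrite degP; lia.
rewrite mul1r in hi.
have /sectionsE bi := hb i.
have b0 : b i <> 0 by move=> b0; apply: hi; exists 0; rewrite b0 rmorph0.
have off Q : Q != P -> 0 <= Q (b i).
  move=> /negbTE ne; case: (bi Q) => //; by rewrite /point_div ne.
exists (b i); split=> //.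
apply/eqP; rewrite eq_le; apply/andP; split; last first.
  by case: (bi P) => //; rewrite /point_div eqxx.
rewrite leNgt; apply/negP => h; apply: hi; apply: sections_0; right=> Q.
rewrite addr0; have [->|/off //] := eqVneq Q P.
by move: (P (b i)) h; lia.
Qed.

Lemma min_degree_place P0 : exists P, forall Q, (pt_degree P <= pt_degree Q)%N.
Proof.
have ex : exists n, `[< exists P : place iota, pt_degree P = n >].
  by exists (pt_degree P0); apply/asboolP; exists P0.
case: (ex_minnP ex) => _ /asboolP[P <-] h; exists P => Q.
by apply: h; apply/asboolP; exists Q.
Qed.

(** Subtracting qP from A leaves a divisor B whose degree is the remainder r, between 0 and p - 1;
    if r were positive, a nonzero section of B would give a contradiction. *)
Lemma pt_degree_dvd P A : (forall Q, (pt_degree P <= pt_degree Q)%N) ->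
  is_divisor A -> ((pt_degree P)%:Z %| deg A)%Z.
Proof.
move=> P_min hA; set p := pt_degree P in P_min *; have p0 : (0 < p)%N := pt_degree_gt0 P.
apply/dvdz_mod0P/eqP; apply: contraTT isT => r0.
pose q := (deg A %/ p)%Z; pose B := fun Q => A Q + point_div P (- q) Q.
have hB : is_divisor B by apply/is_divisorD/is_divisor_point.
have degB : deg B = (deg A %% p)%Z.
  rewrite degD //; last exact: is_divisor_point.
  by rewrite deg_point -/p {1}(divz_eq (deg A) p) -/q; lia.
have r_ge0 : 0 <= (deg A %% p)%Z by apply: modz_ge0; lia.
have r_ltp : (deg A %% p)%Z < p by apply: ltz_pmod; lia.
have [|f f0 Bf] := sections_neq0 hB; first by rewrite degB.
(* If div f + B contains a point Q, then f is a section of B - Q, of negative degree since r < p <=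
   deg Q; otherwise div f = -B and 1/f is a section of -B, of degree -r < 0. *)
case: (pselect (exists Q, 1 <= Q f + B Q)) => [[Q hQ]|hn].
  case/eqP: f0.
  apply: (@sections_neg (fun R => B R + point_div Q (- 1) R)).
  - by apply/is_divisorD/is_divisor_point.
  - rewrite degD //; last exact: is_divisor_point.
    by rewrite deg_point degB; have := P_min Q; lia.
  case: Bf => [->|Bf]; first exact: sections0.
  right=> R; rewrite /point_div; case: eqP => [->|_].
    by move: (Q f) (B Q) hQ; lia.
  by rewrite addr0.
case/eqP: f0; apply/eqP; rewrite -invr_eq0; apply/eqP.
apply: (sections_neg (is_divisorN hB)); first by rewrite degN // degB; lia.
right=> Q; rewrite placeV; have : ~ 1 <= Q f + B Q by move=> h; apply: hn; exists Q.
by move: (Q f) (B Q); lia.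
Qed.

(** * Sections filtered by their pole order at a point *)

Section SimplePole.
Variables (P : place iota) (x : F).
Hypotheses (x_pole : P x = - 1) (x_reg : forall Q, Q != P -> 0 <= Q x).
Local Notation p := (pt_degree P).
Local Notation L n := (sections (point_div P n)).

Let x0 : x != 0.
Proof. by apply: contra_eq_neq x_pole => ->; rewrite val_at0. Qed.

(* [L 1 / k] and the residue field have the same dimension, by Riemann's
   inequality. *)
Lemma principal_part_surj f : local_ring P f ->
  exists2 g, L 1 g & max_ideal P (f - g / x).
Proof.
have hP := is_divisor_point P 1.
have p0 := pt_degree_gt0 P.
have degP : deg (point_div P 1) = p%:Z by rewrite deg_point mul1r.
have [|N [b [hN hb span indep]]] := sections_basis hP; first by rewrite degP.
have [kap [hkap uniq_kap]] := @quot_dimP (local_ring P) (max_ideal P) p0.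
rewrite -/(pt_degree P) in kap hkap uniq_kap.
have xV : val_ge P 1 x^-1 by right; rewrite placeV x_pole.
have bx i : local_ring P (b i / x).
  have /sectionsE/(_ P) := hb i; rewrite /point_div eqxx => h.
  by apply/local_ringE; rewrite -(addNr 1); apply: val_geM.
have coord g : local_ring P g -> exists c : 'I_p -> k,
    max_ideal P (g - \sum_j iota (c j) * kap j).
  by move=> /uniq_kap[c [hc _]]; exists c.
have [c hc] := choice (fun i => coord _ (bx i)).
(* The matrix of g -> g / x from H^0(P) to the residue field of P. *)
pose M := \matrix_(i < N, j < p) c i j.
have comb (r : 'rV[k]_N) : max_ideal P
    ((\sum_i iota (r 0 i) * b i) / x - \sum_j iota ((r *m M) 0 j) * kap j).
  have -> : \sum_j iota ((r *m M) 0 j) * kap j =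
      \sum_i iota (r 0 i) * \sum_j iota (c i j) * kap j.
    under [RHS]eq_bigr => i _ do rewrite mulr_sumr.
    rewrite exchange_big /=; apply: eq_bigr => j _.
    rewrite mxE rmorph_sum mulr_suml; apply: eq_bigr => i _.
    by rewrite rmorphM mulrA mxE.
  rewrite mulr_suml -sumrB; apply/max_idealE/val_ge_sum => i.
  by rewrite -mulrA -mulrBr; apply: val_geZ; apply: hc.
have [l0 hl0] : exists c : 'I_N -> k, 1 = \sum_i iota (c i) * b i.
  by apply: span; apply: sectionsW (sections1 iota) => Q; rewrite /point_div; case: eqP.
(* If g / x lies in the maximal ideal, the section g is regular at P, hence constant; so the kernel
   lies on the line through the coordinates [l0] of 1. *)
have ker_le : (kermx M <= \row_i l0 i)%MS.
  apply/row_subP => i; set r := row i _.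
  have /sub_kermxP rM : (r <= kermx M)%MS by apply: row_sub.
  have := comb r; rewrite rM [X in _ - X]big1 ?subr0; last first.
    by move=> j _; rewrite mxE rmorph0 mul0r.
  set g := \sum_i _ => gx.
  have [a ea] : exists a, g = iota a.
    apply: sections_0; apply/sectionsE => Q; rewrite oppr0.
    have [->|ne] := eqVneq Q P.
      rewrite -[g](divfK x0) -(subrr 1); apply: val_geM => //.
      by right; rewrite x_pole.
    have /sectionsE/(_ Q) : L 1 g by apply: sections_sum => j; apply: sectionsZ.
    by rewrite /point_div (negbTE ne) oppr0.
  suff -> : r = a *: \row_i l0 i by apply: scalemx_sub.
  apply/rowP => j; rewrite [RHS]mxE [X in _ * X]mxE; apply/eqP; rewrite -subr_eq0; apply/eqP.
  apply: (indep (fun j => r 0 j - a * l0 j) _ j); rewrite {j}.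
  under eq_bigr => j' _ do rewrite rmorphB rmorphM mulrBl -mulrA.
  by rewrite sumrB -mulr_sumr -hl0 mulr1 -/g ea subrr.
(* N >= p + 1 and a kernel of rank at most 1 leave rank p. *)
have full : row_full M.
  rewrite -col_leq_rank; have := leq_trans (mxrankS ker_le) (rank_leq_row _).
  by rewrite mxrank_ker; move: hN; rewrite degP; lia.
move=> /coord[e he].
have /submxP[r er] := submx_full (\row_j e j) full.
exists (\sum_i iota (r 0 i) * b i).
  by apply: sections_sum => i; apply: sectionsZ.
have := comb r; rewrite -er; under [X in _ - X]eq_bigr => j _ do rewrite mxE.
set G := _ / x; set E := \sum_j _ => h.
have -> : f - G = (f - E) - (G - E) by rewrite opprB addrA addrNK.
exact/max_idealE/val_geB.
Qed.

(** The residue of f / x^(n+1) at P is that of some g / x, so subtracting x^n g removes the polar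
    part of order n + 1; away from P, [x] and [g] are regular. *)
Lemma filtration_step (n : nat) f : L n.+1%:Z f ->
  exists2 g, L 1 g & L n%:Z (f - x ^+ n * g).
Proof.
move=> Lf; have /sectionsE hf := Lf.
have xn0 e : x ^+ e != 0 by rewrite expf_neq0.
have [|g Lg hg] := @principal_part_surj (f / x ^+ n.+1).
  apply/local_ringE; rewrite -(addNr n.+1%:Z); apply: val_geM.
    by have := hf P; rewrite /point_div eqxx.
  by right; rewrite placeV placeX // x_pole; lia.
exists g => //; apply/sectionsE => Q.
have [->|ne] := eqVneq Q P; rewrite /point_div ?eqxx ?(negbTE ne).
  have -> : f - x ^+ n * g = (f / x ^+ n.+1 - g / x) * x ^+ n.+1.
    rewrite mulrBl divfK // exprSr mulrA mulrAC divfK // mulrC [g * _]mulrC.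
    by [].
  apply: (@val_geW _ _ _ _ (1 + - n.+1%:Z)); first by lia.
  by apply: val_geM => //; right; rewrite placeX // x_pole; lia.
apply: val_geB; first by have := hf Q; rewrite /point_div (negbTE ne).
have /sectionsE/(_ Q) := Lg; rewrite /point_div (negbTE ne) -{2}[- 0]add0r.
by apply: val_geM; right; rewrite placeX //; have := x_reg ne; nia.
Qed.

(** The pole orders n + l down to n + 1 are peeled off one by one; each correction x^(n+i) g is x^n
    times x^i g, whose pole at P has order at most i + 1. *)
Lemma filtration_split (n l : nat) f : L (n + l)%N%:Z f ->
  exists al be, [/\ L n%:Z al, L l%:Z be & f = al + x ^+ n * be].
Proof.
elim: l f => [|l IH] f.
  rewrite addn0 => Lf; exists f, 0; split=> //; first exact: sections0.
  by rewrite mulr0 addr0.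
rewrite addnS => /filtration_step[g Lg /IH[al [be [Lal Lbe e]]]].
exists al, (be + x ^+ l * g); split=> //.
  apply: sectionsD.
    by apply: sectionsW Lbe => Q; rewrite /point_div; case: eqP => // _; lia.
  apply: sections_shift Lg => [|Q]; first by rewrite expf_neq0.
  rewrite placeX // /point_div; case: eqP => [->|/eqP/x_reg].
    by rewrite x_pole; lia.
  by move: (Q x) => z; nia.
by rewrite mulrDr addrA -e mulrA -exprD subrK.
Qed.

End SimplePole.

(** For P of least degree, x with a simple pole there, and [a] with div a = nP - A, the pencil is u
    = a, v = x^n a. As sections of A, [a] generates away from P and x^n a generates at P. *)
Lemma pencil A : is_divisor A -> 0 < deg A -> exists u v,
  [/\ sections A u /\ sections A v,
      forall B, is_divisor B -> 0 <= deg B -> forall f,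
        sections (fun Q => A Q + B Q) f -> exists c al be,
        [/\ sections B c, sections A al, sections B be & f = al * c + v * be],
      forall f, sections (fun Q => A Q + A Q) f -> exists al be,
        [/\ sections A al, sections A be & f = u * al + v * be] &
      forall B al be,
        sections (fun Q => A Q + B Q) al -> sections (fun Q => A Q + B Q) be ->
        u * al + v * be = 0 ->
        exists ga, [/\ sections B ga, al = v * ga & be = - u * ga]].
Proof.
move=> hA degA.
(* A divisor of positive degree is nonzero, which supplies a place. *)
have [P0 _] : exists P0, A P0 != 0.
  case: (pselect (exists P0, A P0 != 0)) => // h.
  move: degA; rewrite (_ : A = fun=> 0) ?deg0 //.
  by apply/funext => Q; apply/eqP/negPn/negP => ne; apply: h; exists Q.
have [P P_min] := min_degree_place P0; have [x [x_pole x_reg]] := simple_pole P.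
have x0 : x != 0 by apply: contra_eq_neq x_pole => ->; rewrite val_at0.
have p0 := pt_degree_gt0 P.
(* B is equivalent to a multiple of P: the degree of P divides that of B, and divisors of degree 0
   are principal. *)
have xdiv B : is_divisor B -> 0 <= deg B -> exists (n : nat) c,
    c != 0 /\ forall Q, Q c = point_div P n%:Z Q - B Q.
  move=> hB degB; have /dvdzP[q eq] := pt_degree_dvd P_min hB.
  have q0 : 0 <= q by rewrite -(@pmulr_lge0 _ (pt_degree P)%:Z) -?eq //; lia.
  have [|| c c0 hc] := @deg0_principal (fun Q => B Q + point_div P (- q) Q).
  - by apply/is_divisorD/is_divisor_point.
  - rewrite degD //; last exact: is_divisor_point.
    by rewrite deg_point eq mulNr addrN.
  exists `|q|%N, c; split=> // Q; rewrite hc gez0_abs // /point_div.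
  by case: eqP => _; lia.
have [|n [a [a0 ha]]] := xdiv A hA; first exact: ltW.
have xn0 : x ^+ n != 0 by rewrite expf_neq0.
have Pxn : P (x ^+ n) = - n%:Z by rewrite placeX // x_pole; lia.
have Pxn_reg Q : Q != P -> 0 <= Q (x ^+ n).
  by move=> /x_reg; rewrite placeX //; nia.
have Aa : sections A a.
  by right=> Q; rewrite ha /point_div; case: eqP => _; lia.
have Ax : sections A (x ^+ n * a).
  right=> Q; rewrite val_atM // ha /point_div; case: eqP => [->|/eqP/Pxn_reg].
    by rewrite Pxn; lia.
  by move: (Q _) => z; lia.
have step B c (l : nat) f : c != 0 -> (forall Q, Q c = point_div P l%:Z Q - B Q) ->
    sections (fun Q => A Q + B Q) f -> exists al be,
    [/\ sections A al, sections B be & f = al * c + (x ^+ n * a) * be].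
  move=> c0 hc Lf.
  (* Division by a c carries H^0(A + B) into H^0((n + l)P), where [filtration_split] applies. *)
  have [|al [be [Lal Lbe e]]] :=
    @filtration_split P x x_pole x_reg n l ((a * c)^-1 * f).
    have ac0 : (a * c)^-1 != 0 by rewrite invr_eq0 mulf_neq0.
    apply: (sections_shift ac0 _ Lf) => Q.
    rewrite placeV val_atM // ha hc /point_div; case: eqP => _; lia.
  exists (a * al), (c * be); split.
  - by apply: sections_shift Lal => // Q; rewrite ha; lia.
  - by apply: sections_shift Lbe => // Q; rewrite hc; lia.
  - have -> : f = a * c * ((a * c)^-1 * f) by rewrite mulVKf // mulf_neq0.
    by rewrite e; ring.
exists a, (x ^+ n * a); split=> //.
- move=> B hB degB f Lf; have [l [c [c0 hc]]] := xdiv B hB degB.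
  have [al [be [Aal Bbe e]]] := step B c l f c0 hc Lf.
  exists c, al, be; split=> //.
  by right=> Q; rewrite hc /point_div; case: eqP => _; lia.
(* With B = A one may take c = a = u. *)
- move=> f Lf; have [al [be [Aal Bbe e]]] := step A a n f a0 ha Lf.
  by exists al, be; split=> //; rewrite e [al * a]mulrC.
move=> B al be Lal Lbe syz.
have {}syz : al = - (x ^+ n * be).
  by apply/eqP; rewrite -addr_eq0 -(mulrI_eq0 _ (mulfI a0)) mulrDr mulrCA mulrA -syz.
(* At P the same function is al / (x^n a), whose denominator generates A there; elsewhere [a]
   does. *)
exists (- (be / a)); split; last 1 first.
- by rewrite mulrN mulNr opprK mulrC divfK.
- apply/sectionsE => Q; have [->|ne] := eqVneq Q P.
    have -> : - (be / a) = al / (x ^+ n * a).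
      by rewrite syz mulNr -mulf_div divff // mul1r.
    have -> : - B P = - (A P + B P) + A P by lia.
    apply: val_geM; first by move/sectionsE: Lal => /(_ P).
    by right; rewrite placeV val_atM // Pxn ha /point_div eqxx; lia.
  have -> : - B Q = - (A Q + B Q) + A Q by lia.
  apply/val_geN/val_geM; first by move/sectionsE: Lbe => /(_ Q).
  by right; rewrite placeV ha /point_div (negbTE ne); lia.
- by rewrite syz mulrN -mulrA [a * _]mulrC divfK.
Qed.

End GenusZero.

(** * Multiples of the log canonical divisor *)

Section LogCanonical.
Variables (k F : fieldType) (iota : {rmorphism k -> F}).
Local Open Scope ring_scope.

Lemma floor_mul_divisor (X : log_stacky_curve iota) (K : place iota -> int) d :
  is_divisor K -> is_divisor (floor_mul (log_canonical X K) d).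
Proof.
move=> hK; have : finite_set ([set P | K P != 0%R] `|`
    ([set P | stab_order X P != 1%N] `|` log_pts X))%classic.
  rewrite !finite_setU; split=> //; split; [exact: stacky_finite|exact: log_pts_finite].
apply: sub_finite_set => P /=; apply: contraPP => n.
have nK : K P = 0 by apply: contra_notP n => /eqP; left.
have nS : stab_order X P = 1%N by apply: contra_notP n => /eqP; right; left.
have nL : ~ log_pts X P by move=> h; apply: n; right; right.
by rewrite /floor_mul /log_canonical nK nS (asboolF nL) invr1 subrr mulr0 floor0 eqxx.
Qed.

Lemma floor_mulD (D : place iota -> rat) d d' P :
  floor_mul D d P + floor_mul D d' P <= floor_mul D (d + d') P.
Proof.
rewrite /floor_mul floor_ge_int rmorphD natrD mulrDl.
by apply: lerD; apply: floor_le.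
Qed.

(** Turns degree m + d into the sum of divisors that [pencil] works with. *)
Lemma floor_mulD_int (D : place iota -> rat) m d P : m%:R * D P \is a Num.int ->
  floor_mul D (m + d) P = floor_mul D m P + floor_mul D d P.
Proof.
by move=> h; rewrite /floor_mul natrD mulrDl floorDzr.
Qed.

Lemma log_canonical_int (X : log_stacky_curve iota) (K : place iota -> int) m P :
  (stab_order X P %| m)%N -> m%:R * log_canonical X K P \is a Num.int.
Proof.
move=> /dvdnP[q ->]; have s0 := stab_order_gt0 X P.
rewrite /log_canonical !mulrDr mulrN mulr1 natrM.
have -> : q%:R * (stab_order X P)%:R * (stab_order X P)%:R^-1 = q%:R :> rat.
  by rewrite mulfK // pnatr_eq0 -lt0n.
by rewrite !rpredD ?rpredN ?rpredM ?rpred_nat ?intr_int.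
Qed.

End LogCanonical.

(** * The lcm of the stabilizer orders, and the bounds for the canonical ring *)

Lemma dvdn_biglcm_seq (e : seq nat) a : a \in e -> (a %| \big[lcmn/1%N]_(b <- e) b)%N.
Proof.
by move=> ae; rewrite (big_rem a ae) dvdn_lcml.
Qed.

Lemma biglcm_seq_gt0 (e : seq nat) :
  (forall a, a \in e -> (0 < a)%N) -> (0 < \big[lcmn/1%N]_(a <- e) a)%N.
Proof.
move=> h; rewrite big_seq; apply: (big_ind (fun n => 0 < n)%N) => //.
by move=> a b a0 b0; rewrite lcmn_gt0 a0.
Qed.

Local Open Scope ring_scope.

Theorem proposition7p2p3 (k F : fieldType) (iota : {rmorphism k -> F})
    (X : log_stacky_curve iota) (K : place iota -> int)
    (e : seq nat) (delta s : nat)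
    (hK : canonical_divisor K)
    (hsig : has_signature X 0 e delta)
    (htame : tame X)
    (hsep : separably_rooted X)
    (hdeg : 0 < deg (log_canonical X K))
    (hs : is_saturation (Eff (log_canonical X K)) s) :
  let m := \big[lcmn/1%N]_(a <- e) a in
  generated_with_relations iota (section_ring (log_canonical X K))
    (m + s)%N (2 * (m + s))%N.
Proof.
move=> m; have [genus0 e_ge2 e_count _] := hsig.
have [_ const_field _] := coarse_smooth X.
set D := log_canonical X K in hdeg hs *.
have hA d : is_divisor (floor_mul D d) by apply: floor_mul_divisor; case: hK.
have m_gt0 : (0 < m)%N.
  by apply: biglcm_seq_gt0 => a /e_ge2; apply: leq_trans.
have stab_dvd P : (stab_order X P %| m)%N.
  (* A nontrivial order occurs in [e], since it is counted there with the degrees of its points and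
     these are positive. *)
  have := stab_order_gt0 X P; rewrite leq_eqVlt => /orP[/eqP <-|s2]; first exact: dvd1n.
  apply: dvdn_biglcm_seq; rewrite -has_pred1 has_count e_count //.
  set S := [set Q | stab_order X Q = stab_order X P]%classic.
  have S_fin : finite_set S.
    apply: sub_finite_set (stacky_finite X) => Q /= ->.
    by rewrite neq_ltn s2 orbT.
  by rewrite (fsbigD1 P) //= addn_gt0 (pt_degree_gt0 const_field genus0).
have mD_int P : m%:R * D P \is a Num.int by exact: log_canonical_int.
(* mD is integral, so taking floors loses no degree: deg floor(mD) = m deg D. *)
have degm : 0 < deg (floor_mul D m).
  rewrite -(ltr_int rat) -deg_intr // (_ : (fun P => _) = fun P => m%:R * D P).
    by rewrite deg_scale mulr_gt0 // ltr0n.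
  by apply/funext => P; rewrite floorK.
have sec_mD j : sections (floor_mul D (m + j)) =
    sections (fun Q => floor_mul D m Q + floor_mul D j Q).
  by congr sections; apply/funext => Q; apply: floor_mulD_int.
have [u [v [[Au Av] hstep hpencil hsyz]]] := pencil const_field genus0 (hA m) degm.
have sec0 f : sections (floor_mul D 0) f <-> sections (fun _ : place iota => 0) f.
  have -> : floor_mul D 0 = fun=> 0; last by [].
  by apply/funext => P; rewrite /floor_mul mul0r floor0.
apply: (@graded_presentation k F iota (fun d => sections (floor_mul D d)) _ _ _ _ _ _
  m s u v) => //.
- by move=> d; apply: sections0.
- by apply/sec0/sections1.
- by move=> d f g; apply: sectionsD.
- by move=> d c f; apply: sectionsZ.
- move=> d d' f g hf hg; apply: sectionsW (sectionsM hf hg) => P.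
  exact: floor_mulD.
- by move=> f /sec0; apply: sections_0.
(* Saturation enters here: j >= s puts j in Eff(D), so floor(jD) has the nonnegative degree that
   [pencil] requires. *)
- by move=> j f sj; rewrite sec_mD; apply: hstep => //; apply: hs.1.
- by move=> f; rewrite sec_mD; apply: hpencil.
- by move=> d al be; rewrite sec_mD; apply: hsyz.
(* Graded pieces are finite-dimensional: zero when the divisor has negative degree, with a basis
   from Riemann's inequality otherwise. *)
move=> d; have [neg|nneg] := ltP (deg (floor_mul D d)) 0.
  exists 0%N, (fun=> 0); split=> [i|f /(sections_neg const_field genus0 (hA d) neg) ->].
    exact: sections0.
  by exists (fun=> 0); rewrite big_ord0.
by have [N [b [_ ? ? _]]] := sections_basis genus0 (hA d) nneg; exists N, b.
Qed.
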